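(* Let $H,K$ be complex Hilbert spaces, let $A\in CR(K,H)\cap BCR(K,H)$ and $B\in CR(H,K)\cap BCR(H,K)$, and let $$T=\begin{bmatrix} 0 & A \\ B & 0 \end{bmatrix}=\bigl\{\{(x,y),(y_a,x_b)\}:\{x,x_b\}\in B,\ \{y,y_a\}\in A\bigr\},$$ a linear relation in $H\times K$ with domain $H\times K$. Assume that $AB$ and $BA$ are closed linear relations in $H$ and $K$, respectively. Then $$\sigma_{e_1}(T)=\{\lambda\in\mathbb{C}:\lambda^2\in\sigma_{e_1}(AB)\cup\sigma_{e_1}(BA)\}.$$
   Context: A linear relation from a Hilbert space $H$ into a Hilbert space $K$ is a linear subspace $T$ of $H\times K$, whose elements are written $\{x,y\}$; $CR(H,K)$ is the set of those that are closed subspaces. $D(T)=\{x:\{x,y\}\in T\text{ for some }y\}$, $R(T)=\{y:\{x,y\}\in T\text{ for some }x\}$, $N(T)=\{x:\{x,0\}\in T\}$, $M(T)=\{y:\{0,y\}\in T\}$. $Q_T$ is the quotient map $K\to K/\overline{M(T)}$; $T$ is continuous if the operator $Q_TT$ is bounded, and $BCR(H,K)$ is the set of continuous linear relations with $D(T)=H$. Products: $TS=\{\{x,y\}:\{x,z\}\in S,\ \{z,y\}\in T\text{ for some }z\}$. For $\lambda\in\mathbb{C}$, $T-\lambda I=\{\{x,y-\lambda x\}:\{x,y\}\in T\}$. $\phi_+(H,K)$ is the set of closed linear relations from $H$ into $K$ with closed range and $\dim N(T)<\infty$. For a closed linear relation $T$ in a Hilbert space $X$, $\sigma_{e_1}(T)=\{\lambda\in\mathbb{C}:T-\lambda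 I\notin\phi_+(X,X)\}$. $H\times K$ is the Hilbert space direct sum. *)

(* Defs.v *)
From HB Require Import structures.
From mathcomp Require Import all_boot all_order all_algebra.
From mathcomp Require Import sesquilinear complex.
From mathcomp Require Import all_classical all_reals.
From mathcomp Require Import topology normedtype ring.

Set Implicit Arguments.
Unset Strict Implicit.
Unset Printing Implicit Defensive.

Import Order.TTheory GRing.Theory Num.Theory.
Import numFieldNormedType.Exports.

Local Open Scope classical_set_scope.
Local Open Scope ring_scope.
Local Open Scope complex_scope.

HB.mixin Record isHilbert (R : realType) H & CompleteNormedModule R[i] H := {
  inner : {dot H for (@Num.conj R[i])};
  innerE : forall x : H, inner x x = `|x| ^+ 2
}.

#[short(type="hilbertType")]
HB.structure Definition Hilbert (R : realType) :=
  {H of CompleteNormedModule R[i] H & isHilbert R H}.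

(* H * K already carries the sup norm of normedtype; the Hilbert direct sum
   lives on an alias of it. *)
Definition hsum (R : realType) (H K : hilbertType R) : Type := (H * K)%type.

Section HilbertSum.
Variables (R : realType) (H K : hilbertType R).
Local Notation HK := (hsum H K).

HB.instance Definition _ := GRing.Lmodule.copy HK (H * K)%type.

Definition hsum_norm (p : HK) : R[i] := sqrtC (`|p.1| ^+ 2 + `|p.2| ^+ 2).

Let sumsq_ge0 (p : HK) : 0 <= `|p.1| ^+ 2 + `|p.2| ^+ 2 :> R[i].
Proof. by rewrite addr_ge0// exprn_ge0. Qed.

Let sqr_hsum_norm (p : HK) : hsum_norm p ^+ 2 = `|p.1| ^+ 2 + `|p.2| ^+ 2.
Proof. exact: sqrtCK. Qed.

Let hsum_norm_ge0 (p : HK) : 0 <= hsum_norm p.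
Proof. by rewrite sqrtC_ge0. Qed.

Let hsum_normD (p q : HK) : hsum_norm (p + q) <= hsum_norm p + hsum_norm q.
Proof.
have [P Q] := (hsum_norm_ge0 p, hsum_norm_ge0 q).
rewrite -(@ler_pXn2r _ 2%N isT) ?nnegrE ?addr_ge0// sqr_hsum_norm sqrrD.
rewrite !sqr_hsum_norm.
have cs : `|p.1| * `|q.1| + `|p.2| * `|q.2| <= hsum_norm p * hsum_norm q.
  rewrite -(@ler_pXn2r _ 2%N isT) ?nnegrE ?mulr_ge0// ?addr_ge0 ?mulr_ge0//.
  rewrite exprMn !sqr_hsum_norm -subr_ge0.
  set a := `|p.1|; set b := `|p.2|; set c := `|q.1|; set d := `|q.2|.
  rewrite (_ : _ - _ = (a * d - b * c) ^+ 2); last by ring.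
  by rewrite real_exprn_even_ge0// rpredB// rpredM// normr_real.
have tri (V : normedModType R[i]) (x y : V) :
    `|x + y| ^+ 2 <= `|x| ^+ 2 + `|y| ^+ 2 + (`|x| * `|y|) *+ 2.
  rewrite addrAC -sqrrD; apply: lerXn2r; rewrite ?nnegrE ?addr_ge0//.
  exact: ler_normD.
apply: le_trans (lerD (tri _ p.1 q.1) (tri _ p.2 q.2)) _.
rewrite addrACA -mulrnDl [leRHS]addrAC (addrACA (`|p.1| ^+ 2)).
by rewrite lerD2l lerMn2r cs.
Qed.

Let hsum_normZ (l : R[i]) (p : HK) : hsum_norm (l *: p) = `|l| * hsum_norm p.
Proof.
apply/eqP; rewrite -(@eqrXn2 _ 2%N)// ?mulr_ge0// exprMn !sqr_hsum_norm/=.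
by rewrite !normrZ !exprMn mulrDr.
Qed.

Let hsum_norm0_eq0 (p : HK) : hsum_norm p = 0 -> p = 0.
Proof.
move=> /(congr1 (fun t => t ^+ 2)); rewrite sqr_hsum_norm expr0n/= => /eqP.
rewrite paddr_eq0 ?exprn_ge0// !sqrf_eq0 !normr_eq0 => /andP[/eqP p1 /eqP p2].
by case: p p1 p2 => x y /= -> ->.
Qed.

HB.instance Definition _ := Lmodule_isNormed.Build R[i] HK
  hsum_normD hsum_normZ hsum_norm0_eq0.

Lemma sqr_normr_hsum (p : HK) : `|p| ^+ 2 = `|p.1| ^+ 2 + `|p.2| ^+ 2.
Proof. exact: sqr_hsum_norm. Qed.

Lemma normr_fst_hsum (p : HK) : `|p.1| <= `|p|.
Proof.
by rewrite -(@ler_pXn2r _ 2%N isT) ?nnegrE// sqr_normr_hsum lerDl exprn_ge0.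
Qed.

Lemma normr_snd_hsum (p : HK) : `|p.2| <= `|p|.
Proof.
by rewrite -(@ler_pXn2r _ 2%N isT) ?nnegrE// sqr_normr_hsum lerDr exprn_ge0.
Qed.

Lemma normr_hsum_le (p : HK) : `|p| <= `|p.1| + `|p.2|.
Proof.
rewrite -(@ler_pXn2r _ 2%N isT) ?nnegrE ?addr_ge0// sqr_normr_hsum sqrrD.
by rewrite [leRHS]addrAC lerDl mulrn_wge0// mulr_ge0.
Qed.

Let hsum_complete (F : set_system HK) : ProperFilter F -> cauchy F -> cvg F.
Proof.
move=> FF /cauchy_ballP Fc.
have c1 : cvg ((fst : HK -> H) @ F).
  apply: cauchy_cvg; apply/cauchy_ballP => e e0; rewrite near_map2.
  apply: filterS (Fc e e0) => -[p q]; rewrite -!ball_normE/= => pq.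
  exact: le_lt_trans (normr_fst_hsum (p - q)) pq.
have c2 : cvg ((snd : HK -> K) @ F).
  apply: cauchy_cvg; apply/cauchy_ballP => e e0; rewrite near_map2.
  apply: filterS (Fc e e0) => -[p q]; rewrite -!ball_normE/= => pq.
  exact: le_lt_trans (normr_snd_hsum (p - q)) pq.
move/cvg_ex : c1 => [l1 /cvgrPdist_lt c1].
move/cvg_ex : c2 => [l2 /cvgrPdist_lt c2].
apply/cvg_ex; exists ((l1, l2) : HK); apply/cvgrPdist_lt => e e0.
have e20 : 0 < e / 2 by rewrite divr_gt0.
near=> p; apply: le_lt_trans (normr_hsum_le _) _.
rewrite [e]splitr ltrD//=; near: p; [exact: c1|exact: c2].
Unshelve. all: by end_near. Qed.

HB.instance Definition _ := Uniform_isComplete.Build HK hsum_complete.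

Definition hsum_inner (p q : HK) : R[i] :=
  inner p.1 q.1 + inner p.2 q.2.


Let hsum_inner_bilinear : bilinear_for
  (GRing.Scale.Law.clone _ _ *%R _)
  (GRing.Scale.Law.clone _ _ (@Num.conj R[i] \; *%R) _) hsum_inner.
Proof.
split=> [q l p r|p l q r]; rewrite /hsum_inner/=.
  by rewrite !linearPl/= mulrDr addrACA.
by rewrite !linearPr/= mulrDr addrACA.
Qed.

HB.instance Definition _ := bilinear_isBilinear.Build R[i] HK HK R[i]
  _ _ hsum_inner hsum_inner_bilinear.

Let hsum_inner_sym (p q : HK) :
  hsum_inner p q = (-1) ^+ false * (hsum_inner q p)^*%R.
Proof.
rewrite /hsum_inner rmorphD mulrDr.
by rewrite -!(@hermitian_subproof _ _ false).
Qed.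

HB.instance Definition _ := isHermitianSesquilinear.Build R[i] HK false
  (@Num.conj R[i]) hsum_inner hsum_inner_sym.

Let hsum_innerE (p : HK) : hsum_inner p p = `|p| ^+ 2.
Proof. by rewrite /hsum_inner !innerE sqr_normr_hsum. Qed.

Let hsum_inner_gt0 (p : HK) : p != 0 -> 0 < hsum_inner p p.
Proof. by move=> p0; rewrite hsum_innerE exprn_gt0// normr_gt0. Qed.

HB.instance Definition _ :=
  isDotProduct.Build R[i] HK hsum_inner hsum_inner_gt0.

HB.instance Definition _ := isHilbert.Build R HK hsum_innerE.

End HilbertSum.

Section LinearRelations.
Variable R : realType.
Implicit Types H K G X : hilbertType R.

Definition finite_dim H (V : set H) : Prop :=
  exists s : seq H,
    V = [set x | exists c : 'I_(size s) -> R[i], x = \sum_i c i *: s`_i].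

(* A relation from H into K is identified with its graph. *)
Definition linear_relation H K (T : set (hsum H K)) : Prop :=
  submod_closed [in T].

Definition rdom H K (T : set (hsum H K)) : set H :=
  [set x | exists y, T (x, y)].
Definition rran H K (T : set (hsum H K)) : set K :=
  [set y | exists x, T (x, y)].
Definition rker H K (T : set (hsum H K)) : set H := [set x | T (x, 0)].
Definition rmul H K (T : set (hsum H K)) : set K := [set y | T (0, y)].

Definition CR H K : set (set (hsum H K)) :=
  [set T | linear_relation T /\ closed T].

(* Elements of the quotient K / closure M are represented as cosets, i.e. as
   subsets of K; complex.Re only casts the norm, which is real, from R[i] to R
   so that the infimum makes sense. *)
Definition coset K (M : set K) (y : K) : set K :=
  [set y + m | m in closure M].
Definition coset_norm K (C : set K) : R := inf [set complex.Re `|z| | z in C].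

Definition quotient_relation H K (T : set (hsum H K)) : set (H * set K) :=
  [set p | exists2 y, T (p.1, y) & p.2 = coset (rmul T) y].

Definition continuous_relation H K (T : set (hsum H K)) : Prop :=
  exists c : R, forall x C, quotient_relation T (x, C) ->
    coset_norm C <= c * complex.Re `|x|.

Definition BCR H K : set (set (hsum H K)) :=
  [set T | [/\ linear_relation T, continuous_relation T & rdom T = setT]].

Definition rcomp H K G (T : set (hsum K G)) (S : set (hsum H K)) :
    set (hsum H G) :=
  [set p | exists z, S (p.1, z) /\ T (z, p.2)].

Definition rshift X (T : set (hsum X X)) (l : R[i]) : set (hsum X X) :=
  [set p | exists2 y, T (p.1, y) & p.2 = y - l *: p.1].

Definition phi_plus H K : set (set (hsum H K)) :=
  [set T | [/\ CR T, closed (rran T) & finite_dim (rker T)]].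

Definition sigma_e1 X (T : set (hsum X X)) : set R[i] :=
  [set l | ~ phi_plus (rshift T l)].

Definition antidiag_relation H K (A : set (hsum K H)) (B : set (hsum H K)) :
    set (hsum (hsum H K) (hsum H K)) :=
  [set p | B (p.1.1, p.2.2) /\ A (p.1.2, p.2.1)].

End LinearRelations.

(* Main.v *)
Require Import Defs.
From HB Require Import structures.
From mathcomp Require Import all_boot all_order all_algebra.
From mathcomp Require Import sesquilinear complex ring lra.
From mathcomp Require Import all_classical all_reals.
From mathcomp Require Import topology normedtype.

Set Implicit Arguments.
Unset Strict Implicit.
Unset Printing Implicit Defensive.

Import Order.TTheory GRing.Theory Num.Theory.
Import numFieldNormedType.Exports.

Local Open Scope classical_set_scope.
Local Open Scope ring_scope.
Local Open Scope complex_scope.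


(** With W = T - l and W' = T + l, the product W' W is the block diagonal
relation with blocks A B - l^2 and B A - l^2, so the theorem says that W is
upper semi-Fredholm if and only if W' W is.

If W is semi-Fredholm, then so is W', because the sign change
(x, y) |-> (x, - y) turns T into - T; and a closed product of semi-Fredholm
relations is semi-Fredholm ([phi_plus_rcomp]).  Conversely, W' is closed and
defined everywhere, and then a semi-Fredholm product W' W has a semi-Fredholm
right factor W ([phi_plus_of_rcomp]).

Both facts rest on one quantitative description.  A closed relation has closed
range if and only if it satisfies the estimate [lifts_boundedly]: each y in the
range is related to some x with |x| <= c |y|.  One direction is the open mapping
theorem for relations ([open_mapping], through Baire's theorem inside the closed
range), the other one a telescoping series ([closed_rran_of_lifts]).  Since a
relation determines neither the image nor the preimage of a vector, an estimate
holds only modulo a finite-dimensional kernel; what absorbs these errors is that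
a closed subspace plus a finite-dimensional one is closed
([closed_subspace_add_finite_dim]) and that a relation with finite-dimensional
kernel pulls finite-dimensional spaces back to finite-dimensional ones
([finite_dim_preimage]).

Norms of a complex space take their values in R[i], where the order is partial;
all estimates are therefore made with the real number [rnorm x]. *)

(** * The norm as a real number *)

Section RealNorm.
Variable R : realType.
Implicit Types H K : hilbertType R.

Definition rnorm H (x : H) : R := complex.Re `|x|.

Lemma rnormE H (x : H) : `|x| = (rnorm x)%:C.
Proof. by rewrite /rnorm RRe_real// ger0_real. Qed.

Lemma rnorm_ge0 H (x : H) : 0 <= rnorm x.
Proof. by rewrite -lecR -rnormE; exact: normr_ge0. Qed.

Lemma rnorm_le H (x : H) (e : R) : (rnorm x <= e) = (`|x| <= e%:C).
Proof. by rewrite rnormE lecR. Qed.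

Lemma rnorm_lt H (x : H) (e : R) : (rnorm x < e) = (`|x| < e%:C).
Proof. by rewrite rnormE ltcR. Qed.

Lemma rnorm0 H : rnorm (0 : H) = 0.
Proof. by rewrite /rnorm normr0. Qed.

Lemma rnorm_eq0 H (x : H) : rnorm x = 0 -> x = 0.
Proof. by move=> x0; apply/normr0_eq0; rewrite rnormE x0. Qed.

Lemma rnormN H (x : H) : rnorm (- x) = rnorm x.
Proof. by rewrite /rnorm normrN. Qed.

Lemma rnormB H (x y : H) : rnorm (x - y) = rnorm (y - x).
Proof. by rewrite -rnormN opprB. Qed.

Lemma rnormD H (x y : H) : rnorm (x + y) <= rnorm x + rnorm y.
Proof. by rewrite rnorm_le rmorphD/= -!rnormE ler_normD. Qed.

Lemma rnorm_triangle H (z x y : H) :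
  rnorm (x - y) <= rnorm (x - z) + rnorm (z - y).
Proof. by rewrite -(subrKA z) rnormD. Qed.

Lemma rnormZ H (a : R[i]) (x : H) : rnorm (a *: x) = complex.Re `|a| * rnorm x.
Proof.
apply: complexI; rewrite -rnormE normrZ rmorphM/= -rnormE.
by congr (_ * _); apply/esym/RRe_real/ger0_real.
Qed.

Lemma rnorm_fst H K (p : hsum H K) : rnorm p.1 <= rnorm p.
Proof. by rewrite rnorm_le -rnormE normr_fst_hsum. Qed.

Lemma rnorm_snd H K (p : hsum H K) : rnorm p.2 <= rnorm p.
Proof. by rewrite rnorm_le -rnormE normr_snd_hsum. Qed.

Lemma rnorm_hsum H K (p : hsum H K) : rnorm p <= rnorm p.1 + rnorm p.2.
Proof. by rewrite rnorm_le rmorphD/= -!rnormE normr_hsum_le. Qed.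

Lemma closed_rnormP H (A : set H) : closed A <->
  forall x, (forall e : R, 0 < e -> exists2 y, A y & rnorm (x - y) < e) -> A x.
Proof.
split=> [cA x xA|cA x clx].
  apply: cA => B /nbhs_normP[e /= e0 eB].
  have e0' : 0 < complex.Re e by move: e0; rewrite ltcE => /andP[].
  have [y Ay xy] := xA _ e0'; exists y; split=> //; apply: eB.
  by move: xy; rewrite /= rnorm_lt RRe_real// gtr0_real.
apply: cA => e e0.
have [|y [Ay xy]] := clx (ball x e%:C).
  by apply: nbhsx_ballx; rewrite ltcR.
by exists y => //; rewrite rnorm_lt; move: xy; rewrite -ball_normE.
Qed.

Lemma exists_div_expn2_lt (a e : R) : 0 < e -> exists n, a / 2 ^+ n < e.
Proof.
move=> e0; exists (Num.truncn `|a / e|).+1; rewrite ltr_pdivrMr ?exprn_gt0//.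
rewrite mulrC -ltr_pdivrMr//.
apply: le_lt_trans (ler_norm _) _; apply: lt_trans (truncnS_gt _) _.
by rewrite -natrX ltr_nat ltn_expl.
Qed.

(** Completeness in the only form used below: the increments are dominated by a
sequence that halves at each step, so their sum from n on is at most 2 d_n. *)
Lemma rnorm_complete H (u : nat -> H) (d : nat -> R) :
  (forall n, rnorm (u n.+1 - u n) <= d n) -> (forall n, d n.+1 <= d n / 2) ->
  exists l, forall n, rnorm (l - u n) <= 2 * d n.
Proof.
move=> ud dd.
have d0 n : 0 <= d n by apply: le_trans (ud n); exact: rnorm_ge0.
have tail n k : rnorm (u (n + k)%N - u n) <= 2 * d n - 2 * d (n + k)%N.
  elim: k => [|k IH]; first by rewrite addn0 !subrr rnorm0.
  rewrite addnS; have := rnorm_triangle (u (n + k)%N) (u (n + k).+1) (u n).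
  have := ud (n + k)%N; have := dd (n + k)%N; lra.
have tail2 n k : rnorm (u (n + k)%N - u n) <= 2 * d n.
  have := tail n k; have := d0 (n + k)%N; lra.
have dgeo n : d n <= d 0 / 2 ^+ n.
  elim: n => [|n IH]; first by rewrite expr0 divr1.
  rewrite exprSr invfM mulrA; have := dd n; lra.
have : cvg (u @ \oo).
  apply: cauchy_cvg; apply: cauchy_exP => e e0.
  have e0' : 0 < complex.Re e by move: e0; rewrite ltcE => /andP[].
  have [n dn] := exists_div_expn2_lt (2 * d 0) e0'.
  exists (u n); exists n => //= m nm; rewrite -ball_normE/=.
  rewrite -[e]RRe_real ?gtr0_real// -rnorm_lt rnormB -(subnKC nm).
  by have := tail2 n (m - n)%N; have := dgeo n; lra.
move=> /cvg_ex[l ul]; exists l => n.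
apply/ler_addgt0Pr => e e0.
have /cvgrPdist_lt/(_ e%:C) := ul; rewrite ltcR => /(_ e0)[N _ Nul].
have := Nul (n + N)%N (leq_addl _ _); rewrite /= -rnorm_lt => ?.
have := rnorm_triangle (u (n + N)%N) l (u n); have := tail2 n N; lra.
Qed.

End RealNorm.

(** * Closed subspaces, bounded linear maps and Baire's theorem *)

Section ClosedSubspaces.
Variable R : realType.
Implicit Types G H K : hilbertType R.

Definition linear_subspace H (V : set H) : Prop := submod_closed [in V].

(** On a direct sum this unfolds to [CR]: closed linear relations are treated as
closed subspaces, and most of them are obtained as preimages of others under
bounded linear maps. *)
Definition closed_subspace H (V : set H) : Prop := linear_subspace V /\ closed V.

Lemma linear_subspaceP H (V : set H) :
  V 0 -> (forall a x y, V x -> V y -> V (a *: x + y)) -> linear_subspace V.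
Proof.
move=> V0 VD; split; first by rewrite inE.
by move=> a x y /set_mem Vx /set_mem Vy; rewrite inE; exact: VD.
Qed.

Lemma linear_subspace0 H (V : set H) : linear_subspace V -> V 0.
Proof. by case=> /set_mem. Qed.

Lemma linear_subspaceZD H (V : set H) a x y :
  linear_subspace V -> V x -> V y -> V (a *: x + y).
Proof. by case=> _ VD /mem_set Vx /mem_set Vy; apply: set_mem (VD a _ _ Vx Vy). Qed.

Lemma linear_subspaceD H (V : set H) x y :
  linear_subspace V -> V x -> V y -> V (x + y).
Proof. by move=> sV Vx Vy; rewrite -[x]scale1r; apply: linear_subspaceZD. Qed.

Lemma linear_subspaceZ H (V : set H) a x : linear_subspace V -> V x -> V (a *: x).
Proof.
move=> sV Vx; rewrite -[_ *: x]addr0; apply: linear_subspaceZD => //.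
exact: linear_subspace0.
Qed.

Lemma linear_subspaceB H (V : set H) x y :
  linear_subspace V -> V x -> V y -> V (x - y).
Proof. by move=> sV Vx Vy; rewrite -scaleN1r addrC; apply: linear_subspaceZD. Qed.

(** A bare function is used instead of a bundled linear map so that the graph
coordinates can be manipulated as plain lambda terms. *)
Definition bounded_linear H K (f : H -> K) : Prop :=
  linear f /\ exists c : R, forall x, rnorm (f x) <= c * rnorm x.

Lemma bounded_linear_const H K (f : H -> K) : bounded_linear f ->
  exists2 c : R, 0 < c & forall x, rnorm (f x) <= c * rnorm x.
Proof.
case=> _ [c fc]; exists (`|c| + 1) => [|x].
  by rewrite ltr_wpDl.
apply: le_trans (fc x) _; apply: ler_wpM2r; first exact: rnorm_ge0.
by rewrite (le_trans (ler_norm c))// lerDl.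
Qed.

Lemma bounded_linear_id H : bounded_linear (@id H).
Proof. by split=> //; exists 1 => x; rewrite mul1r. Qed.

Lemma bounded_linear_zero H K : bounded_linear (fun _ : H => 0 : K).
Proof.
by split=> [a x y|]; [rewrite scaler0 addr0|exists 0 => x; rewrite rnorm0 mul0r].
Qed.

Lemma bounded_linear_fst G H K (f : G -> hsum H K) :
  bounded_linear f -> bounded_linear (fun x => (f x).1).
Proof.
case=> lf [c fc]; split=> [a x y|]; first by rewrite lf.
by exists c => x; apply: le_trans (rnorm_fst _) (fc x).
Qed.

Lemma bounded_linear_snd G H K (f : G -> hsum H K) :
  bounded_linear f -> bounded_linear (fun x => (f x).2).
Proof.
case=> lf [c fc]; split=> [a x y|]; first by rewrite lf.
by exists c => x; apply: le_trans (rnorm_snd _) (fc x).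
Qed.

Lemma bounded_linear_pair G H K (f : G -> H) (g : G -> K) :
  bounded_linear f -> bounded_linear g ->
  bounded_linear (fun x => (f x, g x) : hsum H K).
Proof.
move=> [lf [c fc]] [lg [d gd]]; split=> [a x y|]; first by rewrite lf lg.
exists (c + d) => x; apply: le_trans (rnorm_hsum _) _ => /=.
by rewrite mulrDl lerD.
Qed.

Lemma bounded_linear_addZ H K (a : R[i]) (f g : H -> K) :
  bounded_linear f -> bounded_linear g ->
  bounded_linear (fun x => f x + a *: g x).
Proof.
move=> [lf [c fc]] [lg [d gd]]; split=> [b x y|].
  rewrite lf lg !scalerDr !scalerA [a * b]mulrC -!addrA; congr (_ + _).
  by rewrite addrCA.
exists (c + complex.Re `|a| * d) => x; apply: le_trans (rnormD _ _) _.
rewrite mulrDl lerD// rnormZ -mulrA ler_wpM2l//.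
by rewrite -lecR RRe_real ?normr_ge0 ?ger0_real.
Qed.

Lemma bounded_linearD H K (f g : H -> K) : bounded_linear f ->
  bounded_linear g -> bounded_linear (fun x => f x + g x).
Proof.
move=> bf /(bounded_linear_addZ 1 bf); congr bounded_linear.
by apply/funext => x; rewrite scale1r.
Qed.

Lemma bounded_linearN H K (f : H -> K) :
  bounded_linear f -> bounded_linear (fun x => - f x).
Proof.
move=> /(bounded_linear_addZ (-1) (@bounded_linear_zero H K)).
by congr bounded_linear; apply/funext => x; rewrite scaleN1r add0r.
Qed.

Lemma bounded_linearB H K (f g : H -> K) : bounded_linear f ->
  bounded_linear g -> bounded_linear (fun x => f x - g x).
Proof. by move=> bf /bounded_linearN; exact: bounded_linearD. Qed.

Lemma closed_subspace_preimage H K (f : H -> K) (V : set K) :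
  bounded_linear f -> closed_subspace V -> closed_subspace (f @^-1` V).
Proof.
move=> bf [sV cV]; have [lf _] := bf; split.
  apply: linear_subspaceP => [|a x y Vx Vy] /=; last by rewrite lf; exact: linear_subspaceZD.
  have := lf (-1) 0 0; rewrite !scaleN1r !addNr => ->; exact: linear_subspace0.
have [c c0 fc] := bounded_linear_const bf.
apply/closed_rnormP => x xV; apply: (closed_rnormP V).1 => // e e0.
have [|y Vy xy] := xV (e / c); first by rewrite divr_gt0.
exists (f y) => //; have -> : f x - f y = f (x - y).
  by rewrite -scaleN1r addrC -lf scaleN1r addrC.
by apply: le_lt_trans (fc _) _; rewrite mulrC -ltr_pdivlMr.
Qed.

Lemma closed_subspaceI H (V W : set H) :
  closed_subspace V -> closed_subspace W -> closed_subspace (V `&` W).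
Proof.
move=> [sV cV] [sW cW]; split; last exact: closedI.
apply: linear_subspaceP => [|a x y [Vx Wx] [Vy Wy]]; first by split; exact: linear_subspace0.
by split; exact: linear_subspaceZD.
Qed.

Lemma closed_subspace_zero H : closed_subspace [set (0 : H)].
Proof.
split; first by apply: linear_subspaceP => // a x y -> ->; rewrite scaler0 addr0.
apply/closed_rnormP => x x0; apply: rnorm_eq0; apply/eqP.
rewrite eq_le rnorm_ge0 andbT; apply/ler_addgt0Pl => e /x0[_ ->].
by rewrite subr0 addr0 => /ltW.
Qed.

Lemma linear_subspace_rran H K (T : set (hsum H K)) :
  linear_subspace T -> linear_subspace (rran T).
Proof.
move=> sT; apply: linear_subspaceP; first by exists 0; exact: linear_subspace0 sT.
by move=> a y y' [x Tx] [x' Tx']; exists (a *: x + x'); exact: linear_subspaceZD sT Tx Tx'.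
Qed.

Lemma closed_subspace_rker H K (T : set (hsum H K)) :
  CR T -> closed_subspace (rker T).
Proof.
apply: closed_subspace_preimage.
by apply: bounded_linear_pair; [exact: bounded_linear_id|exact: bounded_linear_zero].
Qed.

Lemma rker_sub H K (T : set (hsum H K)) x x' y :
  linear_subspace T -> T (x, y) -> T (x', y) -> rker T (x - x').
Proof.
by move=> sT Txy Tx'y; have := linear_subspaceB sT Txy Tx'y; rewrite /rker /=; congr T;
   congr pair; exact: subrr.
Qed.

(** Baire's theorem inside a closed set C: if the sets F n cover C, one of them is
dense in a relative ball of C.  Otherwise one can choose shrinking relative
balls, each step avoiding the next F n; their centres converge to a point of C
that no F n contains. *)
Lemma Baire_closed_cover H (C : set H) (F : nat -> set H) :
  closed C -> C !=set0 -> C `<=` \bigcup_n F n ->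
  exists n x (r : R), [/\ C x, 0 < r & forall y, C y -> rnorm (y - x) < r ->
    forall e, 0 < e -> exists2 z, F n z & rnorm (y - z) < e].
Proof.
move=> cC [x0 Cx0] CF; apply: contrapT => nobal.
pose P (s : nat * (H * R)) (t : H * R) := C s.2.1 -> 0 < s.2.2 ->
  [/\ C t.1, 0 < t.2, t.2 <= s.2.2 / 2, rnorm (t.1 - s.2.1) <= s.2.2 / 4 &
   forall z, F s.1 z -> t.2 <= rnorm (t.1 - z)].
have [f Pf] : {f & forall s, P s (f s)}.
  apply: choice => -[n [x r]]; rewrite /P/=.
  have [Cx|nCx] := pselect (C x); last by exists (x, r).
  have [r0|nr0] := pselect (0 < r); last by exists (x, r).
  apply: contrapT => nt; apply: nobal; exists n, x, (r / 4); split => //.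
    by rewrite divr_gt0.
  move=> y Cy yx e e0; apply: contrapT => nz; apply: nt.
  exists (y, Num.min e (r / 2)) => _ _ /=; split => //.
  - by rewrite lt_min e0 divr_gt0.
  - by rewrite ge_min lexx orbT.
  - exact: ltW.
  - move=> z Fz; rewrite ge_min; apply/orP; left; rewrite leNgt; apply/negP => yz.
    by apply: nz; exists z.
(* s n is the pair (centre, radius) of the n-th ball; centres move by at most a
   quarter of the radius, so the limit remains inside half of each ball. *)
pose s := fix s n := if n is m.+1 then f (m, s m) else (x0, 1).
have sC n : C (s n).1 /\ 0 < (s n).2.
  elim: n => [|n [Cn rn]] //=.
  by have [] := Pf (n, s n) Cn rn.
have sP n : [/\ (s n.+1).2 <= (s n).2 / 2,
    rnorm ((s n.+1).1 - (s n).1) <= (s n).2 / 4 &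
    forall z, F n z -> (s n.+1).2 <= rnorm ((s n.+1).1 - z)].
  by have [Cn rn] := sC n; have [] := Pf (n, s n) Cn rn.
have [n|n|l sl] := @rnorm_complete R H (fun n => (s n).1) (fun n => (s n).2 / 4).
- by have [] := sP n.
- by have [] := sP n; lra.
have /CF[n _ Fl] : C l.
  apply: (closed_rnormP C).1 => // e e0; have [n en] := exists_div_expn2_lt 1 e0.
  exists (s n).1; first by have [] := sC n.
  suff : (s n).2 <= 1 / 2 ^+ n by have := sl n; have := (sC n).2; lra.
  elim: n {en} => [|n IH]; first by rewrite expr0 divr1.
  by rewrite exprSr invfM mulrA; have [] := sP n; lra.
have [_ _ /(_ _ Fl)] := sP n; rewrite rnormB.
by have := sl n.+1; have := (sC n.+1).2; lra.
Qed.

End ClosedSubspaces.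

(** * The open mapping theorem for relations *)

Section OpenMapping.
Variable R : realType.
Implicit Types G H K : hilbertType R.

Definition lifts_boundedly H K (T : set (hsum H K)) : Prop :=
  exists2 c : R, 0 < c & forall y, rran T y ->
    exists2 x, T (x, y) & rnorm x <= c * rnorm y.

Lemma rcomplex_norm (a : R) : 0 <= a -> complex.Re `|a%:C| = a.
Proof. by move=> a0; rewrite ger0_norm// lecR. Qed.

(** The range is covered by the images of the balls of radius n, so one of
these images is dense in a relative ball around some y0.  Differences of its
elements approximate every small vector of the range, and homogeneity gives an
approximate solution for every y. *)
Lemma almost_open H K (T : set (hsum H K)) : CR T -> closed (rran T) ->
  exists2 c : R, 0 < c & forall y, rran T y -> exists x' y',
    [/\ T (x', y'), rnorm (y - y') <= rnorm y / 2 & rnorm x' <= c * rnorm y].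
Proof.
move=> [sT _] cR; have sR := linear_subspace_rran sT.
have [||n [y0 [r [Ry0 r0 dense_n]]]] := @Baire_closed_cover R K (rran T)
    (fun n => [set y | exists2 x, T (x, y) & rnorm x <= n%:R]) cR.
- by exists 0; exact: linear_subspace0.
- move=> y [x Txy]; exists (Num.truncn (rnorm x)).+1 => //=; exists x => //.
  by apply/ltW/truncnS_gt.
exists (4 * n.+1%:R / r) => [|y Ry]; first by rewrite divr_gt0// mulr_gt0.
have [->|y_neq0] := eqVneq y 0.
  exists 0, 0; split; first exact: linear_subspace0 sT.
    by rewrite subrr rnorm0 mul0r.
  by rewrite !rnorm0 mulr0.
have ny : 0 < rnorm y.
  by rewrite lt_neqAle rnorm_ge0 andbT eq_sym; apply: contra_neq y_neq0 => /rnorm_eq0.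
(* [a *: y] has norm [r / 2], so [y0 + a *: y] lies in the ball. *)
pose a : R := r / (2 * rnorm y).
have a0 : 0 < a by rewrite divr_gt0// mulr_gt0.
have ay : rnorm (a%:C *: y) = r / 2.
  by rewrite rnormZ rcomplex_norm; [rewrite /a; field|exact: ltW]; rewrite gt_eqF.
have e0 : 0 < r / 8 by rewrite divr_gt0.
have [||y1 [x1 T1 x1n] y1e] := dense_n (a%:C *: y + y0) _ _ _ e0.
- exact: linear_subspaceZD.
- by rewrite addrK ay; lra.
have [||y2 [x2 T2 x2n] y2e] := dense_n y0 _ _ _ e0; first by [].
  by rewrite subrr rnorm0.
have aC : a%:C != 0 :> R[i] by rewrite gt_eqF// ltcR.
exists (a^-1%:C *: (x1 - x2)), (a^-1%:C *: (y1 - y2)); split.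
- exact: (linear_subspaceZ _ sT (linear_subspaceB sT T1 T2)).
- have -> : y - a^-1%:C *: (y1 - y2) =
      a^-1%:C *: ((a%:C *: y + y0 - y1) - (y0 - y2)).
    rewrite [_ + y0 - y1]addrAC opprB [y2 - y0]addrC addrA addrK -addrA.
    rewrite [RHS]scalerDr scalerA -rmorphM mulVf ?gt_eqF// scale1r.
    by rewrite -scalerN opprB [y2 - y1]addrC.
  rewrite rnormZ rcomplex_norm; last by rewrite invr_ge0 ltW.
  have -> : rnorm y / 2 = a^-1 * (r / 4) by rewrite /a; field; rewrite !gt_eqF.
  apply: ler_wpM2l; first by rewrite invr_ge0 ltW.
  have := rnormD (a%:C *: y + y0 - y1) (- (y0 - y2)); rewrite rnormN; lra.
- rewrite rnormZ rcomplex_norm; last by rewrite invr_ge0 ltW.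
  have -> : 4 * n.+1%:R / r * rnorm y = a^-1 * (2 * n.+1%:R).
    by rewrite /a; field; rewrite !gt_eqF.
  apply: ler_wpM2l; first by rewrite invr_ge0 ltW.
  have := rnormD x1 (- x2); rewrite rnormN -natr1; lra.
Qed.

(** Solving approximately halves the residual; the sum of the successive
corrections converges to an exact solution because T is closed. *)
Lemma open_mapping H K (T : set (hsum H K)) :
  CR T -> closed (rran T) -> lifts_boundedly T.
Proof.
move=> crT cR; have [sT cT] := crT; have sR := linear_subspace_rran sT.
have [c c0 approx] := almost_open crT cR.
have [f Pf] : {f : K -> hsum H K & forall y, rran T y ->
    [/\ T (f y), rnorm (y - (f y).2) <= rnorm y / 2 &
        rnorm (f y).1 <= c * rnorm y]}.
  apply: (@choice _ _ (fun y p => rran T y -> [/\ T p,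
    rnorm (y - p.2) <= rnorm y / 2 & rnorm p.1 <= c * rnorm y])) => y.
  have [Ry|] := pselect (rran T y); last by exists 0.
  by have [x' [y' P]] := approx y Ry; exists (x', y').
exists (2 * c) => [|y Ry]; first by rewrite mulr_gt0.
(* res n is what remains of y after n corrections, sol n their sum. *)
pose res := fix res n := if n is m.+1 then res m - (f (res m)).2 else y.
pose sol := fix sol n := if n is m.+1 then sol m + (f (res m)).1 else 0 : H.
have Rres n : rran T (res n).
  elim: n => //= n IH; apply: linear_subspaceB => //.
  by have [Tf _ _] := Pf _ IH; exists (f (res n)).1; rewrite -surjective_pairing.
have Tsol n : T (sol n, y - res n).
  elim: n => [|n IH] /=; first by rewrite subrr; exact: linear_subspace0 sT.
  have [Tf _ _] := Pf _ (Rres n); have := linear_subspaceD sT IH Tf.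
  by congr T; congr pair; rewrite opprB addrA addrAC.
have [n|n|l lsol] := @rnorm_complete R H sol (fun n => c * rnorm (res n)).
- by rewrite /= addrAC subrr add0r; have [] := Pf _ (Rres n).
- by rewrite -mulrA ler_pM2l//=; have [] := Pf _ (Rres n).
exists l; last by have := lsol 0%N; rewrite /= subr0 mulrA.
apply: (closed_rnormP T).1 => // e e0.
have [n ne] := exists_div_expn2_lt ((2 * c + 1) * rnorm y) e0.
exists (sol n, y - res n); first exact: Tsol.
apply: le_lt_trans (rnorm_hsum _) (le_lt_trans _ ne) => /=.
rewrite subKr.
have resn : rnorm (res n) <= rnorm y / 2 ^+ n.
  elim: n {ne} => [|n IH]; first by rewrite expr0 divr1.
  by rewrite exprSr invfM mulrA /=; have [] := Pf _ (Rres n); lra.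
apply: (@le_trans _ _ ((2 * c + 1) * rnorm (res n))).
  by have := lsol n; lra.
by rewrite -mulrA ler_wpM2l//; lra.
Qed.

(** A limit y of the range is the sum of a fast converging series of elements of
the range; bounded lifts of its terms have a convergent sum, which T relates to
y since T is closed. *)
Lemma closed_rran_of_lifts H K (T : set (hsum H K)) :
  CR T -> lifts_boundedly T -> closed (rran T).
Proof.
move=> [sT cT] [c c0 lift]; have sR := linear_subspace_rran sT.
apply/closed_rnormP => y yR.
have [v Pv] : {v : nat -> K & forall n, rran T (v n) /\ rnorm (y - v n) < 1 / 2 ^+ n}.
  apply: (@choice _ _ (fun n w => rran T w /\ rnorm (y - w) < 1 / 2 ^+ n)) => n.
  have [|v Rv yv] := yR (1 / 2 ^+ n); last by exists v.
  by rewrite divr_gt0// exprn_gt0.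
have [d Pd] : {d : nat -> H & forall n, T (d n, v n.+1 - v n) /\
    rnorm (d n) <= c * rnorm (v n.+1 - v n)}.
  apply: (@choice _ _ (fun n x => T (x, v n.+1 - v n) /\
    rnorm x <= c * rnorm (v n.+1 - v n))) => n.
  have [|x] := lift (v n.+1 - v n); last by exists x.
  by apply: linear_subspaceB => //; apply: (Pv _).1.
have [x0 Tx0] := (Pv 0).1.
pose u := fix u n := if n is m.+1 then u m + d m else x0.
have Tu n : T (u n, v n).
  elim: n => //= n IH; have := linear_subspaceD sT IH (Pd n).1.
  by congr T; congr pair; rewrite /= addrC subrK.
have [n|n|l lu] := @rnorm_complete R H u (fun n => c * (2 / 2 ^+ n)).
- rewrite /= addrAC subrr add0r; apply: le_trans (Pd n).2 _.
  rewrite ler_pM2l//; have := rnorm_triangle y (v n.+1) (v n).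
  have := (Pv n).2; have := (Pv n.+1).2; rewrite exprSr invfM [rnorm (_ - y)]rnormB.
  have : 0 <= (2 ^+ n : R)^-1 by rewrite invr_ge0 exprn_ge0.
  by rewrite !mul1r; lra.
- by rewrite exprSr invfM !mulrA.
exists l; apply: (closed_rnormP T).1 => // e e0.
have [n ne] := exists_div_expn2_lt (4 * c + 1) e0.
exists (u n, v n); first exact: Tu.
apply: le_lt_trans (rnorm_hsum _) (le_lt_trans _ ne) => /=.
by have := lu n; have := (Pv n).2; rewrite mulrDl; lra.
Qed.

End OpenMapping.

(** * Finite-dimensional subspaces *)

Section FiniteDimension.
Variable R : realType.
Implicit Types G H K : hilbertType R.

Definition lin_span H (s : seq H) : set H :=
  [set x | exists c : 'I_(size s) -> R[i], x = \sum_i c i *: s`_i].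

Lemma lin_span_nil H : lin_span [::] = [set (0 : H)].
Proof.
apply/seteqP; split=> x /=; first by move=> [c ->]; rewrite big_ord0.
by move=> ->; exists (fun=> 0); rewrite big_ord0.
Qed.

Lemma lin_span_cons H (e : H) s :
  lin_span (e :: s) = [set x | exists a y, lin_span s y /\ x = a *: e + y].
Proof.
apply/seteqP; split=> x /=.
  move=> [c ->]; rewrite big_ord_recl; exists (c ord0), (\sum_i c (lift ord0 i) *: s`_i).
  by split => //; exists (fun i => c (lift ord0 i)).
move=> [a [y [[c ->] ->]]].
exists (fun i => oapp c a (unlift ord0 i)).
rewrite big_ord_recl unlift_none/=; congr (_ + _).
by apply: eq_bigr => i _; rewrite liftK.
Qed.

Lemma linear_subspace_lin_span H (s : seq H) : linear_subspace (lin_span s).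
Proof.
elim: s => [|e s IH]; first by rewrite lin_span_nil; exact: (closed_subspace_zero H).1.
rewrite lin_span_cons; apply: linear_subspaceP.
  by exists 0, 0; split; [exact: linear_subspace0|rewrite scale0r addr0].
move=> a x y [b [x' [sx ->]]] [c [y' [sy ->]]].
exists (a * b + c), (a *: x' + y'); split; first exact: linear_subspaceZD.
by rewrite scalerDl scalerDr scalerA addrACA.
Qed.

(** Adding one generator e to F enlarges the preimage by at most one dimension:
if x1 is a new vector, related to a *: e + y1 with a != 0, then any other vector
differs from a multiple of x1 by one of the old preimage.  Applied to graphs of
linear maps this gives all closure properties of finite dimension below. *)
Lemma finite_dim_preimage H K (S : set (hsum H K)) (F : set K) :
  linear_subspace S -> finite_dim (rker S) -> finite_dim F ->
  finite_dim [set x | exists2 z, F z & S (x, z)].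
Proof.
move=> sS fS [s ->]; elim: s => [|e s IH].
  congr finite_dim : fS; apply/seteqP; split=> x /=.
    by move=> Sx; exists 0 => //; exists (fun=> 0); rewrite big_ord0.
  by move=> [z [c ->]]; rewrite big_ord0.
rewrite -/(lin_span (e :: s)) lin_span_cons; rewrite -/(lin_span s) in IH.
set V := (X in finite_dim X); set V0 := (X in finite_dim X) in IH.
have V0V : V0 `<=` V.
  move=> x [z sz Sxz]; exists z => //; exists 0, z; split => //.
  by rewrite scale0r add0r.
have [VV0|/existsNP[x1 /not_implyP[[z1 [a [y1 [sy1 z1E]]] S1] nV0x1]]] :=
  pselect (V `<=` V0).
  by have -> : V = V0 by apply/seteqP; split.
have a0 : a != 0.
  apply: contra_notN nV0x1 => /eqP a0; exists z1 => //.
  by rewrite z1E a0 scale0r add0r.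
have [s' V0E] := IH; exists (x1 :: s').
rewrite -/(lin_span (x1 :: s')) lin_span_cons; rewrite -/(lin_span s') in V0E.
rewrite -V0E; apply/seteqP; split=> x.
  move=> [z [b [y [sy zE]]] Sxz].
  exists (b / a), (x - (b / a) *: x1); split; last by rewrite addrC subrK.
  exists (y - (b / a) *: y1).
    apply: (linear_subspaceB _ sy (linear_subspaceZ _ _ sy1)); exact: linear_subspace_lin_span.
  have := linear_subspaceB sS Sxz (linear_subspaceZ (b / a) sS S1); congr S.
  congr pair; rewrite zE z1E /= scalerDr scalerA divfK// opprD addrACA.
  by rewrite subrr add0r.
move=> [b [y [[z sz Syz] ->]]].
exists (b *: z1 + z); last exact: linear_subspaceZD sS S1 Syz.
exists (b * a), (b *: y1 + z); split.
  by apply: linear_subspaceZD => //; exact: linear_subspace_lin_span.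
by rewrite z1E scalerDr scalerA addrA.
Qed.

Lemma finite_dim_linear_preimage H K (f : H -> K) (V : set H) (F : set K) :
  linear_subspace V -> linear f -> finite_dim (V `&` f @^-1` [set 0]) ->
  finite_dim F -> finite_dim (V `&` f @^-1` F).
Proof.
move=> sV lf kf fF.
have f0 : f 0 = 0 by have := lf (-1) 0 0; rewrite !scaleN1r !addNr.
pose S : set (hsum H K) := [set p | V p.1 /\ f p.1 = p.2].
have sS : linear_subspace S.
  apply: linear_subspaceP => [|a p q [Vp fp] [Vq fq]].
    by split => //; exact: linear_subspace0.
  by split; [exact: linear_subspaceZD|rewrite lf fp fq].
have := finite_dim_preimage sS kf fF; congr finite_dim.
apply/seteqP; split=> x /=; first by move=> [z Fz [Vx /= fx]]; rewrite fx.
by move=> [Vx Fx]; exists (f x).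
Qed.

Lemma finite_dim0 H : finite_dim [set (0 : H)].
Proof. by exists [::]; rewrite -lin_span_nil. Qed.

Lemma finite_dim_injective H K (f : H -> K) (V : set H) (F : set K) :
  linear_subspace V -> linear f -> (forall x, V x -> f x = 0 -> x = 0) ->
  (forall x, V x -> F (f x)) -> finite_dim F -> finite_dim V.
Proof.
move=> sV lf f_inj VF fF; have f0 : f 0 = 0.
  by have := lf (-1) 0 0; rewrite !scaleN1r !addNr.
have kf : finite_dim (V `&` f @^-1` [set 0]).
  have := finite_dim0 H; congr finite_dim; apply/seteqP; split=> x /=.
    by move=> ->; split => //; exact: linear_subspace0.
  by case; exact: f_inj.
have := finite_dim_linear_preimage sV lf kf fF; congr finite_dim.
by apply/seteqP; split=> x //= => [[]//|Vx]; split => //; exact: VF.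
Qed.

Lemma finite_dim_sub H (V F : set H) :
  linear_subspace V -> V `<=` F -> finite_dim F -> finite_dim V.
Proof.
by move=> sV VF; apply: (@finite_dim_injective _ _ id).
Qed.

Lemma finite_dim_pair H K (V : set H) (W : set K) :
  linear_subspace V -> linear_subspace W -> finite_dim V -> finite_dim W ->
  finite_dim ([set p | V p.1 /\ W p.2] : set (hsum H K)).
Proof.
move=> sV sW fV fW.
pose V1 : set (hsum H K) := [set p | V p.1].
have sV1 : linear_subspace V1.
  apply: linear_subspaceP => [|a p q]; first exact: linear_subspace0 sV.
  exact: linear_subspaceZD sV.
apply: (@finite_dim_linear_preimage (hsum H K) K (fun p => p.2) V1 W) => //.
apply: (@finite_dim_injective (hsum H K) H (fun p => p.1) _ V) => //.
- apply: linear_subspaceP => [|a p q [Vp /= p0] [Vq /= q0]].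
    by split; [exact: linear_subspace0 sV|].
  by split; [exact: linear_subspaceZD sV Vp Vq|rewrite /= p0 q0 scaler0 addr0].
- by move=> [x y] /= [_ ->] ->.
- by move=> x [].
Qed.

Lemma rnorm_orthogonal H (x y : H) : inner x y = 0 -> rnorm x <= rnorm (x + y).
Proof.
move=> xy; have yx : inner y x = 0.
  by rewrite (@hermitian_subproof _ _ false)/= xy rmorph0 mulr0.
rewrite -lecR -!rnormE -(@ler_pXn2r _ 2%N) ?nnegrE// -!innerE.
rewrite linearDl/= !linearDr/= xy yx addr0 add0r.
by rewrite lerDl innerE exprn_ge0.
Qed.

(** If x is a limit of multiples of e, its component x0 orthogonal to e is at most
as long as the distance from x to any multiple of e, hence is 0. *)
Lemma closed_line H (e : H) : closed_subspace [set a *: e | a in setT].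
Proof.
split.
  apply: linear_subspaceP => [|a _ _ [b _ <-] [c _ <-]].
    by exists 0 => //; rewrite scale0r.
  by exists (a * b + c) => //; rewrite scalerDl scalerA.
have [->|e0] := eqVneq e 0.
  have -> : [set a *: (0 : H) | a in setT] = [set 0].
    apply/seteqP; split=> x /=; first by move=> [a _ <-]; rewrite scaler0.
    by move=> ->; exists 0 => //; rewrite scaler0.
  exact: (closed_subspace_zero H).2.
apply/closed_rnormP => x xe.
have ee : inner e e != 0 by rewrite innerE sqrf_eq0 normr_eq0.
pose a := inner x e / inner e e.
exists a => //; apply/esym/eqP; rewrite -subr_eq0; apply/eqP.
set x0 := x - a *: e.
have x0e : inner x0 e = 0.
  by rewrite /x0 linearBl/= linearZl/= /a divfK// subrr.
apply: rnorm_eq0; apply/eqP; rewrite eq_le rnorm_ge0 andbT.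
apply/ler_addgt0Pl => d /xe[_ [b _ <-] xb]; rewrite addr0.
apply: le_trans (ltW xb).
have -> : x - b *: e = x0 + (a - b) *: e.
  by rewrite /x0 scalerBl addrA subrK.
by apply: rnorm_orthogonal; rewrite linearZr_LR/= x0e mulr0.
Qed.

End FiniteDimension.

(** * Upper semi-Fredholm relations and their products *)

Section SemiFredholm.
Variable R : realType.
Implicit Types G H K : hilbertType R.

Definition add_set H (V F : set H) : set H :=
  [set z | exists2 v, V v & F (z - v)].

(** Presenting the sum V + F as the range of a closed relation makes
[open_mapping] and [closed_rran_of_lifts] applicable to it; bounded lifts then
mean that z in V + F has a component in V of norm at most c |z|. *)
Definition add_relation H (V F : set H) : set (hsum H H) :=
  [set p | V p.1 /\ F (p.2 - p.1)].

Lemma rran_add_relation H (V F : set H) : rran (add_relation V F) = add_set V F.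
Proof.
by apply/seteqP; split=> z; [move=> [v [Vv Fzv]]|move=> [v Vv Fzv]]; exists v.
Qed.

Lemma CR_add_relation H (V F : set H) :
  closed_subspace V -> closed_subspace F -> CR (add_relation V F).
Proof.
move=> cV cF; have bid := @bounded_linear_id R (hsum H H).
have b1 := bounded_linear_fst bid; have b2 := bounded_linear_snd bid.
exact: closed_subspaceI (closed_subspace_preimage b1 cV)
  (closed_subspace_preimage (bounded_linearB b2 b1) cF).
Qed.

(** If e lies at distance d > 0 from V, then z = a *: e + v has norm at least
d |a|, so that the component a *: e depends boundedly on z. *)
Lemma closed_subspace_add_line H (V : set H) (e : H) :
  closed_subspace V -> closed_subspace (add_set [set a *: e | a in setT] V).
Proof.
move=> cV; have [sV clV] := cV; rewrite -rran_add_relation.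
have crT := CR_add_relation (closed_line e) cV.
split; first exact: linear_subspace_rran crT.1.
have [Ve|nVe] := pselect (V e).
  have -> : rran (add_relation [set a *: e | a in setT] V) = V => //.
  rewrite rran_add_relation; apply/seteqP; split=> z.
    move=> [_ [a _ <-] Vz]; rewrite -(subrK (a *: e) z).
    by apply: linear_subspaceD => //; exact: linear_subspaceZ.
  by move=> Vz; exists 0; [exists 0; rewrite ?scale0r|rewrite subr0].
have [d d0 de] : exists2 d : R, 0 < d & forall v, V v -> d <= rnorm (e - v).
  apply: contrapT => nd; apply: nVe; apply: (closed_rnormP V).1 => // d d0.
  apply: contrapT => nv; apply: nd; exists d => // v Vv; rewrite leNgt.
  by apply/negP => ev; apply: nv; exists v.
have e0 : 0 < rnorm e.
  by apply: lt_le_trans d0 _; rewrite -[e]subr0; apply: de; exact: linear_subspace0.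
apply: closed_rran_of_lifts => //; exists (rnorm e / d) => [|z].
  by rewrite divr_gt0.
move=> [_ [[a _ <-] /= Vz]]; exists (a *: e); first by split => //; exists a.
rewrite rnormZ mulrC -mulrA ler_pM2l// mulrC ler_pdivlMr//.
have [->|a0] := eqVneq a 0; first by rewrite normr0 mul0r rnorm_ge0.
have -> : z = a *: (e - - (a^-1 *: (z - a *: e))).
  by rewrite opprK scalerDr scalerA divff// scale1r addrC subrK.
rewrite rnormZ ler_wpM2l//; last first.
  by apply: de; rewrite -scalerN -scaleN1r scalerA; exact: linear_subspaceZ.
by rewrite -lecR RRe_real ?normr_ge0 ?ger0_real.
Qed.

Lemma closed_subspace_add_finite_dim H (V F : set H) :
  closed_subspace V -> finite_dim F -> closed_subspace (add_set V F).
Proof.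
move=> cV [s ->]; rewrite -/(lin_span s); elim: s => [|e s IH].
  have -> : add_set V (lin_span [::]) = V => //.
  rewrite lin_span_nil; apply/seteqP; split=> z.
    by move=> [v Vv /= /eqP]; rewrite subr_eq0 => /eqP ->.
  by move=> Vz; exists z => //=; rewrite subrr.
have -> : add_set V (lin_span (e :: s)) =
    add_set [set a *: e | a in setT] (add_set V (lin_span s)).
  rewrite lin_span_cons; apply/seteqP; split=> z.
    move=> [v Vv [a [y [sy zE]]]]; exists (a *: e); first by exists a.
    by exists v => //; rewrite addrAC zE addrAC subrr add0r.
  move=> [_ [a _ <-] [v Vv sz]]; exists v => //; exists a, (z - a *: e - v).
  by split => //; rewrite addrAC [RHS]addrC subrK.
exact: closed_subspace_add_line.
Qed.

Lemma phi_plus_lifts H K (T : set (hsum H K)) : phi_plus T -> lifts_boundedly T.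
Proof. by move=> [crT cR _]; exact: open_mapping. Qed.

(** Let y be in the range of T S, through an intermediate z in the range of S.  A
short solution z' of (z', y) in T need not be in the range of S, but z - z' is in
N(T), so z' is in R(S) + N(T).  As this sum is closed, z' has a short component
r in R(S); it differs from z' by an element of N(T), so (r, y) is still in T, and
r lifts through S. *)
Lemma phi_plus_rcomp H K G (S : set (hsum H K)) (T : set (hsum K G)) :
  phi_plus S -> phi_plus T -> CR (rcomp T S) -> phi_plus (rcomp T S).
Proof.
move=> phiS phiT crTS; have [crS cRS fS] := phiS; have [crT cRT fT] := phiT.
have [sS _] := crS; have [sT _] := crT.
have [c c0 liftS] := phi_plus_lifts phiS.
have [d d0 liftT] := phi_plus_lifts phiT.
have cS : closed_subspace (rran S) by split => //; exact: linear_subspace_rran.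
have cN := closed_subspace_rker crT.
have [|b b0 liftD] := open_mapping (CR_add_relation cS cN).
  by rewrite rran_add_relation; have [] := closed_subspace_add_finite_dim cS fT.
split=> //.
  apply: closed_rran_of_lifts => //; exists (c * (b * d)).
    by rewrite !mulr_gt0.
  move=> y [x [z [Sxz Tzy]]].
  have [|z' Tz'y z'y] := liftT y; first by exists z.
  have [|r [/= Rr Nr] rz'] := liftD z'.
    rewrite rran_add_relation; exists z; first by exists x.
    exact: rker_sub Tz'y Tzy.
  have [x' Sx'r x'r] := liftS r Rr.
  exists x'; last first.
    apply: le_trans x'r _; rewrite -!mulrA ler_pM2l//.
    by apply: le_trans rz' _; rewrite ler_pM2l.
  exists r; split => //=.
  have := linear_subspaceB sT Tz'y Nr; congr T; congr pair => /=.
    by rewrite subKr.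
  by rewrite subr0.
have := finite_dim_preimage sS fS fT; congr finite_dim.
by apply/seteqP; split=> x; [move=> [z Tz Sz]|move=> [z [Sz Tz]]]; exists z.
Qed.

(** Let N be the kernel of V W.  If (x, y) is in W, then V relates y to a short z,
and z has a short preimage u under V W; since x - u is in N, every element of the
range of W is reached by a short vector modulo N.  This is a bound for W + N x 0,
which is closed, as N is finite-dimensional, and has the same range as W. *)
Lemma phi_plus_of_rcomp H K G (W : set (hsum H K)) (V : set (hsum K G)) :
  CR W -> CR V -> rdom V = setT -> phi_plus (rcomp V W) -> phi_plus W.
Proof.
move=> crW crV domV phiVW; have [crVW _ fN] := phiVW; have [sVW _] := crVW.
have [sW _] := crW; have [sV _] := crV.
have sWN := (closed_subspace_rker crW).1.
have sN := (closed_subspace_rker crVW).1.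
set N := rker (rcomp V W) in fN sN.
have WN : rker W `<=` N.
  by move=> x Wx; exists 0; split => //; exact: linear_subspace0 sV.
split=> //; last exact: finite_dim_sub fN.
have [c c0 liftVW] := phi_plus_lifts phiVW.
pose iV : set (hsum G K) := [set p | V (p.2, p.1)].
have domE y : rran iV y by have : rdom V y by rewrite domV.
have [d d0 liftV] : lifts_boundedly iV.
  apply: open_mapping; last first.
    by have -> : rran iV = setT by apply/seteqP; split.
  have bid := @bounded_linear_id R (hsum G K).
  exact: closed_subspace_preimage (bounded_linear_pair (bounded_linear_snd bid)
    (bounded_linear_fst bid)) crV.
pose N0 : set (hsum H K) := [set p | N p.1 /\ p.2 = 0].
have sN0 : linear_subspace N0.
  apply: linear_subspaceP => [|a p q [Np p0] [Nq q0]].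
    by split => //; exact: linear_subspace0 sN.
  by split; [exact: linear_subspaceZD sN Np Nq|rewrite /= p0 q0 scaler0 addr0].
have fN0 : finite_dim N0.
  apply: (@finite_dim_injective _ (hsum H K) H (fun p => p.1) _ N) => //.
    by move=> [x y] /= [_ /= ->] ->.
  by move=> p [].
have crWN := closed_subspace_add_finite_dim crW fN0.
have <- : rran (add_set W N0) = rran W.
  apply/seteqP; split=> y.
    move=> [x [[x' y'] Wxy [_ /= /eqP]]]; rewrite subr_eq0 => /eqP ->.
    by exists x'.
  move=> [x Wxy]; exists x; exists (x, y) => //; rewrite subrr.
  exact: linear_subspace0 sN0.
apply: closed_rran_of_lifts => //; exists (c * d); first by rewrite mulr_gt0.
move=> y [x [[x' y'] Wxy [_ /= /eqP]]]; rewrite subr_eq0 => /eqP ->.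
have [z Vyz zy] := liftV y' (domE y').
have [|u VWuz uz] := liftVW z; first by exists x'; exists y'.
exists u; last by apply: le_trans uz _; rewrite -mulrA ler_pM2l.
exists (x', y') => //; split; last exact: subrr.
apply: (rker_sub sVW VWuz); by exists y'.
Qed.

End SemiFredholm.

(** * Shifts and block relations *)

Section Shift.
Variables (R : realType) (X : hilbertType R) (T : set (hsum X X)) (l : R[i]).

Lemma rshiftE (x y : X) : Defs.rshift T l (x, y) <-> T (x, y + l *: x).
Proof.
split=> [[z /= Txz ->]|Txy]; first by rewrite subrK.
by exists (y + l *: x); rewrite //= addrK.
Qed.

Lemma CR_rshift : CR T -> CR (Defs.rshift T l).
Proof.
have -> : Defs.rshift T l = (fun p : hsum X X => (p.1, p.2 + l *: p.1)) @^-1` T.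
  by apply/seteqP; split=> -[x y] /rshiftE.
have bid := @bounded_linear_id R (hsum X X).
apply: closed_subspace_preimage; apply: bounded_linear_pair.
  exact: bounded_linear_fst.
by apply: bounded_linear_addZ; [exact: bounded_linear_snd|exact: bounded_linear_fst].
Qed.

Lemma rdom_rshift : rdom T = setT -> rdom (Defs.rshift T l) = setT.
Proof.
move=> dT; apply/seteqP; split=> // x _; have [y Txy] : rdom T x by rewrite dT.
by exists (y - l *: x); apply/rshiftE; rewrite subrK.
Qed.

End Shift.

Section BlockRelations.
Variables (R : realType) (H K : hilbertType R).

Definition diag_relation (U : set (hsum H H)) (V : set (hsum K K)) :
    set (hsum (hsum H K) (hsum H K)) :=
  [set p | U (p.1.1, p.2.1) /\ V (p.1.2, p.2.2)].

Let bid := @bounded_linear_id R (hsum (hsum H K) (hsum H K)).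
Let b1 := bounded_linear_fst bid.
Let b2 := bounded_linear_snd bid.

Lemma CR_diag_relation U V : CR U -> CR V -> CR (diag_relation U V).
Proof.
move=> crU crV; exact: closed_subspaceI
  (closed_subspace_preimage
    (bounded_linear_pair (bounded_linear_fst b1) (bounded_linear_fst b2)) crU)
  (closed_subspace_preimage
    (bounded_linear_pair (bounded_linear_snd b1) (bounded_linear_snd b2)) crV).
Qed.

Lemma CR_antidiag_relation A B :
  CR A -> CR B -> CR (antidiag_relation A B : set (hsum (hsum H K) (hsum H K))).
Proof.
move=> crA crB; exact: closed_subspaceI
  (closed_subspace_preimage
    (bounded_linear_pair (bounded_linear_fst b1) (bounded_linear_snd b2)) crB)
  (closed_subspace_preimage
    (bounded_linear_pair (bounded_linear_snd b1) (bounded_linear_fst b2)) crA).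
Qed.

Lemma rdom_antidiag_relation (A : set (hsum K H)) (B : set (hsum H K)) :
  rdom A = setT -> rdom B = setT -> rdom (antidiag_relation A B) = setT.
Proof.
move=> dA dB; apply/seteqP; split=> // -[x y] _.
have [b Bxb] : rdom B x by rewrite dB.
have [a Aya] : rdom A y by rewrite dA.
by exists (a, b).
Qed.

Lemma phi_plus_diag_relation U V : CR U -> CR V ->
  phi_plus (diag_relation U V) <-> phi_plus U /\ phi_plus V.
Proof.
move=> crU crV; have crD := CR_diag_relation crU crV.
have [[sU _] [sV _]] := (crU, crV).
have sNU := (closed_subspace_rker crU).1; have sNV := (closed_subspace_rker crV).1.
have inl : bounded_linear (fun x : H => (x, 0) : hsum H K).
  by apply: bounded_linear_pair; [exact: bounded_linear_id|exact: bounded_linear_zero].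
have inr : bounded_linear (fun y : K => (0, y) : hsum H K).
  by apply: bounded_linear_pair; [exact: bounded_linear_zero|exact: bounded_linear_id].
split=> [[_ cR fN]|[[_ cU fU] [_ cV fV]]].
  have cRD : closed_subspace (rran (diag_relation U V)).
    by split => //; exact: linear_subspace_rran crD.1.
  split; split => //.
  - have [_] := closed_subspace_preimage inl cRD; congr closed.
    apply/seteqP; split=> u; first by move=> [[x y] [Uxu _]]; exists x.
    by move=> [x Uxu]; exists (x, 0); split => //; exact: (linear_subspace0 sV).
  - apply: (finite_dim_injective sNU inl.1 _ _ fN) => [x _ [//]|x Ux].
    by split => //; exact: (linear_subspace0 sV).
  - have [_] := closed_subspace_preimage inr cRD; congr closed.
    apply/seteqP; split=> u; first by move=> [[x y] [_ Vyu]]; exists y.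
    by move=> [y Vyu]; exists (0, y); split => //; exact: (linear_subspace0 sU).
  - apply: (finite_dim_injective sNV inr.1 _ _ fN) => [y _ [//]|y Vy].
    by split => //; exact: (linear_subspace0 sU).
split=> //; last exact: (finite_dim_pair sNU sNV).
have bHK := @bounded_linear_id R (hsum H K).
have [_] := closed_subspaceI
  (closed_subspace_preimage (bounded_linear_fst bHK)
     (conj (linear_subspace_rran sU) cU : closed_subspace (rran U)))
  (closed_subspace_preimage (bounded_linear_snd bHK)
     (conj (linear_subspace_rran sV) cV : closed_subspace (rran V))).
congr closed; apply/seteqP; split=> -[u v].
  by move=> [[x Uxu] [y Vyv]]; exists (x, y).
by move=> [[x y] [Uxu Vyv]]; split; [exists x|exists y].
Qed.

(** This is (T + l) (T - l) = T^2 - l^2, valid for multivalued A and B because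
both factors of the product can use the same values of A y and B x. *)
Lemma rcomp_rshift_antidiag (A : set (hsum K H)) (B : set (hsum H K)) (l : R[i]) :
  linear_relation A -> linear_relation B -> let T := antidiag_relation A B in
  rcomp (Defs.rshift T (- l)) (Defs.rshift T l) =
  diag_relation (Defs.rshift (rcomp A B) (l ^+ 2)) (Defs.rshift (rcomp B A) (l ^+ 2)).
Proof.
move=> sA sB /=; apply/seteqP; split=> -[[x y] [u v]].
  move=> [[a b]] [/rshiftE[/= Bx Ay] /rshiftE[/= Ba Ab]].
  split; apply/rshiftE => /=.
    exists (b + l *: y); split => //=.
    have := linear_subspaceZD l sA Ay Ab; congr A; congr pair => /=.
      by rewrite addrC.
    by rewrite scalerDr scalerA -expr2 scaleNr addrC subrKA.
  exists (a + l *: x); split => //=.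
  have := linear_subspaceZD l sB Bx Ba; congr B; congr pair => /=.
    by rewrite addrC.
  by rewrite scalerDr scalerA -expr2 scaleNr addrC subrKA.
move=> [/= /rshiftE[b [/= Bxb Abu]] /rshiftE[a [/= Aya Bav]]].
exists (a - l *: x, b - l *: y); split; apply/rshiftE; split=> /=.
- by rewrite subrK.
- by rewrite subrK.
- have := linear_subspaceZD (- l) sB Bxb Bav; congr B; congr pair => /=.
    by rewrite scaleNr addrC.
  by rewrite scalerBr scalerA mulNr -expr2 !scaleNr opprK addrCA.
- have := linear_subspaceZD (- l) sA Aya Abu; congr A; congr pair => /=.
    by rewrite scaleNr addrC.
  by rewrite scalerBr scalerA mulNr -expr2 !scaleNr opprK addrCA.
Qed.

(** T + l is obtained from T - l by the sign changes (x, y) |-> (x, - y) on the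
argument and (u, v) |-> (- u, v) on the value. *)
Lemma phi_plus_rshift_antidiagN (A : set (hsum K H)) (B : set (hsum H K)) (l : R[i]) :
  CR A -> CR B -> let T := antidiag_relation A B in
  phi_plus (Defs.rshift T l) -> phi_plus (Defs.rshift T (- l)).
Proof.
move=> crA crB T [_ cR fN]; have [sA _] := crA.
have crT : CR T by exact: CR_antidiag_relation.
have [sWl _] := CR_rshift l crT.
have crW := CR_rshift (- l) crT.
have flip x y u v : Defs.rshift T (- l) ((x, y), (u, v)) <->
    Defs.rshift T l ((x, - y), (- u, v)).
  split=> /rshiftE[/= Bx Ay]; apply/rshiftE; split=> /=.
  - by rewrite scalerN -scaleNr.
  - by have := linear_subspaceZ (-1) sA Ay; congr A;
       congr pair; rewrite /= scaleN1r ?opprD ?scaleNr ?opprK.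
  - by rewrite scaleNr -scalerN.
  - by have := linear_subspaceZ (-1) sA Ay; congr A;
       congr pair; rewrite /= scaleN1r ?opprD ?scaleNr ?opprK.
have bHK := @bounded_linear_id R (hsum H K).
have [b1' b2'] := (bounded_linear_fst bHK, bounded_linear_snd bHK).
have bneg1 : bounded_linear (fun p : hsum H K => (- p.1, p.2) : hsum H K).
  exact: bounded_linear_pair (bounded_linearN b1') b2'.
have bneg2 : bounded_linear (fun p : hsum H K => (p.1, - p.2) : hsum H K).
  exact: bounded_linear_pair b1' (bounded_linearN b2').
split=> //.
  have [_] := closed_subspace_preimage bneg1
     (conj (linear_subspace_rran sWl) cR : closed_subspace (rran (Defs.rshift T l))).
  congr closed; apply/seteqP; split=> -[u v].
    by move=> [[x y] W]; exists (x, - y); apply/flip; rewrite opprK.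
  by move=> [[x y] /flip W]; exists (x, - y).
apply: (finite_dim_injective (closed_subspace_rker crW).1 bneg2.1 _ _ fN).
  by move=> [x y] _ [-> /eqP]; rewrite oppr_eq0 => /eqP ->.
by move=> [x y] /flip; rewrite oppr0.
Qed.

End BlockRelations.

(** * The essential spectrum of the block relation *)

Theorem theorem4p5 (R : realType) (H K : hilbertType R)
    (A : set (hsum K H)) (B : set (hsum H K))
    (crA : CR A) (bcrA : BCR A) (crB : CR B) (bcrB : BCR B)
    (crAB : CR (rcomp A B)) (crBA : CR (rcomp B A)) :
  sigma_e1 (antidiag_relation A B) =
  [set l : R[i] | (sigma_e1 (rcomp A B) `|` sigma_e1 (rcomp B A)) (l ^+ 2)].
Proof.
have [[_ _ dA] [_ _ dB]] := (bcrA, bcrB).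
have [[sA _] [sB _]] := (crA, crB).
have crT : CR (antidiag_relation A B) by exact: CR_antidiag_relation.
suff phiE l : phi_plus (Defs.rshift (antidiag_relation A B) l) <->
    phi_plus (Defs.rshift (rcomp A B) (l ^+ 2)) /\
    phi_plus (Defs.rshift (rcomp B A) (l ^+ 2)).
  apply/seteqP; split=> l; rewrite /sigma_e1/= phiE.
    by move=> /not_andP.
  by move=> [] nphi [].
have crU := CR_rshift (l ^+ 2) crAB; have crV := CR_rshift (l ^+ 2) crBA.
rewrite -phi_plus_diag_relation// -rcomp_rshift_antidiag//; split=> phi.
  apply: phi_plus_rcomp => //; first exact: phi_plus_rshift_antidiagN.
  by rewrite rcomp_rshift_antidiag//; exact: CR_diag_relation.
apply: phi_plus_of_rcomp phi; [exact: CR_rshift|exact: CR_rshift|].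
by apply: rdom_rshift; exact: rdom_antidiag_relation.
Qed.
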